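(* Suppose that $G$ and $H$ are two groups and $\mathcal{F}$ and $\mathcal{L}$ are two generating families on $G$ and $H$ respectively. If $(G,\lambda_{\mathcal{F}})$ and $(H,\lambda_{\mathcal{L}})$ admit a set theoretic coupling, then they are asymptotically equivalent.
   Context: For subsets $A,B$ of a group $G$ put $AB=\{gh\mid g\in A,h\in B\}$ and $A^{-1}=\{g^{-1}\mid g\in A\}$. A generating family $\mathcal{F}$ on $G$ is a family of subsets of $G$ that contains a nonempty subset of $G$ and such that $A\cup B$, $AB$, $A^{-1}\in\mathcal{F}$ for all $A,B\in\mathcal{F}$. Standing assumption: every generating family satisfies $G=\bigcup_{F\in\mathcal{F}}F$. $\hat{\mathcal{F}}$ denotes the family of all subsets of members of $\mathcal{F}$. For $A,B\subseteq G$, $A\lambda_{\mathcal{F}}B$ means that there exists $K\in\mathcal{F}$ with $A\subseteq BK$ and $B\subseteq AK$. A subset $A\subseteq G$ is bounded if $A=\emptyset$ or $A\lambda_{\mathcal{F}}\{x\}$ for some $x\in G$. Set theoretic coupling: a nonempty set $X$ is a set theoretic coupling for $(G,\lambda_{\mathcal{F}})$ and $(H,\lambda_{\mathcal{L}})$ if $G$ acts on $X$ from the left and $H$ acts on $X$ from the right, these actions commute with each other, and there exists a subset $O\subseteq X$ such that: (i) $GO=OH=X$; (ii) for each $F\in\hat{\mathcal{F}}$ and $K\in\hat{\mathcal{L}}$, $F_G(K)=\{g\in G\mid gOK\cap OK\neq\emptyset\}\in\hat{\mathcal{F}}$ and $F_H(F)=\{h\in H\mid FOh\cap FO\neq\emptyset\}\in\hat{\mathcal{L}}$;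 (iii) for each $F\in\mathcal{F}$ there exists $E_H(F)\in\mathcal{L}$ with $FO\subseteq OE_H(F)$, and for each $K\in\mathcal{L}$ there exists $E_G(K)\in\mathcal{F}$ with $OK\subseteq E_G(K)O$. Asymptotic equivalence: a map $f:G\to H$ is an AS.R mapping from $(G,\lambda_{\mathcal{F}})$ to $(H,\lambda_{\mathcal{L}})$ if the inverse image of each bounded subset of $H$ is bounded in $G$ and $A\lambda_{\mathcal{F}}B$ implies $f(A)\lambda_{\mathcal{L}}f(B)$ for all $A,B\subseteq G$. The two spaces are asymptotically equivalent if there are AS.R mappings $f:G\to H$ and $\tilde f:H\to G$ with $\tilde f(f(A))\lambda_{\mathcal{F}}A$ for all $A\subseteq G$ and $f(\tilde f(B))\lambda_{\mathcal{L}}B$ for all $B\subseteq H$. *)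

(* Defs.v *)
From mathcomp Require Import all_boot all_classical.
Set Implicit Arguments.
Unset Strict Implicit.
Unset Printing Implicit Defensive.

Local Open Scope classical_set_scope.

Definition mulg_set (G : groupType) (A B : set G) : set G :=
  [set (g * h)%g | g in A & h in B].

Definition invg_set (G : groupType) (A : set G) : set G :=
  [set (g^-1)%g | g in A].

Record generating_family (G : groupType) (F : set (set G)) : Prop :=
  GeneratingFamily {
    gf_nonempty : exists2 A, F A & A !=set0;
    gf_setU : forall A B, F A -> F B -> F (A `|` B);
    gf_mulg : forall A B, F A -> F B -> F (mulg_set A B);
    gf_invg : forall A, F A -> F (invg_set A);
    gf_cover : [set: G] = \bigcup_(A in F) A
  }.

Definition hat (G : groupType) (F : set (set G)) : set (set G) :=
  [set A | exists2 B, F B & A `<=` B].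

Definition as_rel (G : groupType) (F : set (set G)) (A B : set G) : Prop :=
  exists K, [/\ F K, A `<=` mulg_set B K & B `<=` mulg_set A K].

Definition as_bounded (G : groupType) (F : set (set G)) (A : set G) : Prop :=
  A = set0 \/ exists x, as_rel F A [set x].

Definition asr_map (G H : groupType) (F : set (set G)) (L : set (set H))
    (f : G -> H) : Prop :=
  (forall B, as_bounded L B -> as_bounded F (f @^-1` B)) /\
  (forall A B, as_rel F A B -> as_rel L (f @` A) (f @` B)).

Definition asymptotically_equivalent (G H : groupType) (F : set (set G))
    (L : set (set H)) : Prop :=
  exists (f : G -> H) (f' : H -> G),
    [/\ asr_map F L f, asr_map L F f',
        forall A : set G, as_rel F (f' @` (f @` A)) A
      & forall B : set H, as_rel L (f @` (f' @` B)) B].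

Definition left_action (G : groupType) (X : Type) (la : G -> X -> X) : Prop :=
  (forall x, la 1%g x = x) /\
  (forall g g' x, la (g * g')%g x = la g (la g' x)).

Definition right_action (H : groupType) (X : Type) (ra : X -> H -> X) : Prop :=
  (forall x, ra x 1%g = x) /\
  (forall x h h', ra x (h * h')%g = ra (ra x h) h').

Definition lact_set (G : groupType) (X : Type) (la : G -> X -> X)
    (A : set G) (S : set X) : set X :=
  [set la g x | g in A & x in S].

Definition ract_set (H : groupType) (X : Type) (ra : X -> H -> X)
    (S : set X) (B : set H) : set X :=
  [set ra x h | x in S & h in B].

(* F_G(K) = {g | gOK meets OK} *)
Definition return_left (G H : groupType) (X : Type) (la : G -> X -> X)
    (ra : X -> H -> X) (O : set X) (K : set H) : set G :=
  [set g | lact_set la [set g] (ract_set ra O K) `&` ract_set ra O K !=set0].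

(* F_H(A) = {h | AOh meets AO} *)
Definition return_right (G H : groupType) (X : Type) (la : G -> X -> X)
    (ra : X -> H -> X) (O : set X) (A : set G) : set H :=
  [set h | ract_set ra (lact_set la A O) [set h] `&` lact_set la A O !=set0].

Record coupling_domain (G H : groupType) (F : set (set G)) (L : set (set H))
    (X : Type) (la : G -> X -> X) (ra : X -> H -> X) (O : set X) : Prop :=
  CouplingDomain {
    cd_left_cover : lact_set la [set: G] O = [set: X];
    cd_right_cover : ract_set ra O [set: H] = [set: X];
    cd_return_left : forall K, hat L K -> hat F (return_left la ra O K);
    cd_return_right : forall A, hat F A -> hat L (return_right la ra O A);
    cd_left_to_right : forall A, F A ->
      exists2 E, L E & lact_set la A O `<=` ract_set ra O E;
    cd_right_to_left : forall K, L K ->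
      exists2 E, F E & ract_set ra O K `<=` lact_set la E O
  }.

Record set_theoretic_coupling (G H : groupType) (F : set (set G))
    (L : set (set H)) (X : Type) (la : G -> X -> X) (ra : X -> H -> X) : Prop :=
  SetTheoreticCoupling {
    stc_nonempty : [set: X] !=set0;
    stc_left : left_action la;
    stc_right : right_action ra;
    stc_commute : forall g x h, ra (la g x) h = la g (ra x h);
    stc_domain : exists O : set X, coupling_domain F L la ra O
  }.

Definition admit_coupling (G H : groupType) (F : set (set G))
    (L : set (set H)) : Prop :=
  exists (X : Type) (la : G -> X -> X) (ra : X -> H -> X),
    set_theoretic_coupling F L la ra.

(* Main.v *)
Require Import Defs.
From mathcomp Require Import all_boot all_classical.

(** Fix a base point [x0] and let [R g h] mean that g^-1 x0 h lies in the coupling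
    domain [O].  As the translates of [O] cover [X], the relation [R] is total on
    both sides.  If [R g h] and [R g' h'], the point g^-1 x0 h' lies both in
    O (h^-1 h') and in (g^-1 g') O; so if one of g^-1 g', h^-1 h' stays in a fixed
    member of its family, the other is a return element for that member.  Hence
    any functions G -> H and H -> G selected from [R] are coarse inverses. *)

Set Implicit Arguments.
Unset Strict Implicit.
Unset Printing Implicit Defensive.

Local Open Scope classical_set_scope.
Local Open Scope group_scope.

Section GeneratingFamily.
Variables (G : groupType) (F : set (set G)).
Hypothesis genF : generating_family F.

Lemma gf_mem (x : G) : exists2 A, F A & A x.
Proof.
by have : [set: G] x by []; rewrite (gf_cover genF) => -[A FA Ax]; exists A.
Qed.

(** The two inclusions defining [as_rel] constrain b^-1 a and a^-1 b respectively. Replacing [K] by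
    its union with its inverse lets both be read through a^-1 b. *)
Lemma as_relP (A B : set G) :
  as_rel F A B <->
  exists2 K, F K & (forall a, A a -> exists2 b, B b & K (a^-1 * b)) /\
                   (forall b, B b -> exists2 a, A a & K (a^-1 * b)).
Proof.
split=> [[K [FK AB BA]]|[K FK [AB BA]]].
  exists (invg_set K `|` K); first exact/(gf_setU genF)/FK/(gf_invg genF).
  split=> [a /AB[b Bb [k Kk <-]]|b /BA[a Aa [k Kk <-]]].
    by exists b => //; left; exists k => //; rewrite invgM mulgVK.
  by exists a => //; right; rewrite mulKg.
exists (invg_set K `|` K); split.
- exact/(gf_setU genF)/FK/(gf_invg genF).
- move=> a /AB[b Bb Kab]; exists b => //; exists (a^-1 * b)^-1.
    by left; exists (a^-1 * b).
  by rewrite invgM invgK mulVKg.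
- move=> b /BA[a Aa Kab]; exists a => //; exists (a^-1 * b); first by right.
  by rewrite mulVKg.
Qed.

End GeneratingFamily.

(** A coarse Lipschitz condition, put on relations so that flipping [R] gives the reverse direction
    and pairs from different selections can be compared. *)
Definition controlled (G H : groupType) (F : set (set G)) (L : set (set H))
    (R : G -> H -> Prop) : Prop :=
  forall A, F A -> exists2 B, L B &
    forall g g' h h', R g h -> R g' h' -> A (g^-1 * g') -> B (h^-1 * h').

Section ControlledRelation.
Variables (G H : groupType) (F : set (set G)) (L : set (set H)).
Hypotheses (genF : generating_family F) (genL : generating_family L).
Variables (R : G -> H -> Prop) (f : G -> H) (f' : H -> G).
Hypotheses (Rf : forall g, R g (f g)) (Rf' : forall h, R (f' h) h).
Hypotheses (cR : controlled F L R) (cR' : controlled L F (fun h g => R g h)).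

Lemma controlled_asr_map : asr_map F L f.
Proof.
split=> [B [->|[y /(as_relP genL)[K LK [By _]]]]|A B].
- by left; rewrite preimage_set0.
(* [f] need not be onto, so the preimage of a nonempty [B] may be empty; only a nonempty set can be
   [as_rel]-related to a singleton. *)
- have [[g0 Bg0]|/set0P] := pselect (f @^-1` B !=set0); last first.
    by move/negP/negPn/eqP; left.
  (* The centre [y] is pulled back by [f']: [cR'] compares the pair (g, f g) with (f' y, y). *)
  right; exists (f' y); apply/(as_relP genF).
  have [C FC KC] := cR' LK.
  have near g : (f @^-1` B) g -> C (g^-1 * f' y).
    by move=> /By[_ -> Kgy]; exact: KC (Rf g) (Rf' y) Kgy.
  exists C => //; split=> [g Bg|_ ->]; first by exists (f' y) => //; exact: near.
  by exists g0 => //; exact: near.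
- move=> /(as_relP genF)[K FK [AB BA]]; apply/(as_relP genL).
  have [C LC KC] := cR FK.
  exists C => //; split=> [_ [a /AB[b Bb Kab] <-]|_ [b /BA[a Aa Kab] <-]].
    by exists (f b); [exists b|exact: KC (Rf a) (Rf b) Kab].
  by exists (f a); [exists a|exact: KC (Rf a) (Rf b) Kab].
Qed.

(** Both [g] and [f' (f g)] are [R]-related to [f g], so [cR'] applies at displacement 1 and bounds
    their distance uniformly in [g]. *)
Lemma controlled_section_close (A : set G) : as_rel F (f' @` (f @` A)) A.
Proof.
apply/(as_relP genF).
have [K LK K1] := gf_mem genL 1.
have [C FC KC] := cR' LK.
have close g : C ((f' (f g))^-1 * g).
  by apply: KC (Rf' (f g)) (Rf g) _; rewrite mulVg.
exists C => //; split=> [_ [_ [g Ag <-] <-]|g Ag]; first by exists g.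
by exists (f' (f g)) => //; exists (f g) => //; exists g.
Qed.

End ControlledRelation.

Section Coupling.
Variables (G H : groupType) (F : set (set G)) (L : set (set H)).
Hypotheses (genF : generating_family F) (genL : generating_family L).
Variables (X : Type) (la : G -> X -> X) (ra : X -> H -> X) (O : set X) (x0 : X).
Hypotheses (laP : left_action la) (raP : right_action ra).
Hypothesis commute : forall g x h, ra (la g x) h = la g (ra x h).
Hypothesis domO : coupling_domain F L la ra O.

Let R (g : G) (h : H) : Prop := O (la g^-1 (ra x0 h)).

Lemma coupling_left_total (g : G) : exists h, R g h.
Proof.
have [ra1 raM] := raP.
have : [set: X] (la g^-1 x0) by [].
rewrite -(cd_right_cover domO) => -[o Oo [h _ oh]].
by exists h^-1; rewrite /R -commute -oh -raM mulgV ra1.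
Qed.

Lemma coupling_right_total (h : H) : exists g, R g h.
Proof.
have [la1 laM] := laP.
have : [set: X] (ra x0 h) by [].
rewrite -(cd_left_cover domO) => -[g _ [o Oo go]].
by exists g; rewrite /R -go -laM mulVg la1.
Qed.

Lemma coupling_controlled : controlled F L R.
Proof.
have [la1 laM] := laP; have [_ raM] := raP.
(* [A] may miss 1; adjoining [A1] ensures that the enlarged set times [O] contains [O] itself, as
   well as the translate by g^-1 g'. *)
move=> A FA; have [A1 FA1 A11] := gf_mem genF 1.
have [|B LB retB] := cd_return_right domO (A := A `|` A1).
  by exists (A `|` A1) => //; exact: (gf_setU genF).
exists B => // g g' h h' Oo Oo' Agg'; apply: retB.
exists (la g^-1 (ra x0 h')); split.
  exists (la g^-1 (ra x0 h)).
    by exists 1; [right|exists (la g^-1 (ra x0 h)) => //; rewrite la1].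
  by exists (h^-1 * h') => //; rewrite commute -raM mulVKg.
exists (g^-1 * g'); first by left.
by exists (la g'^-1 (ra x0 h')) => //; rewrite -laM mulgK.
Qed.

Lemma coupling_controlled_sym : controlled L F (fun h g => R g h).
Proof.
have [_ laM] := laP; have [ra1 raM] := raP.
move=> K LK; have [K1 LK1 K11] := gf_mem genL 1.
have [|B FB retB] := cd_return_left domO (K := K `|` K1).
  by exists (K `|` K1) => //; exact: (gf_setU genL).
exists B => // h h' g g' Oo Oo' Khh'; apply: retB.
(* The same common point as before, with 1 now used on the right: g'^-1 x0 h' must lie in [O] times
   the enlarged [K]. *)
exists (la g^-1 (ra x0 h')); split.
  exists (g^-1 * g') => //; exists (la g'^-1 (ra x0 h')).
    by exists (la g'^-1 (ra x0 h')) => //; exists 1; [right|rewrite ra1].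
  by rewrite -laM mulgK.
exists (la g^-1 (ra x0 h)) => //.
by exists (h^-1 * h'); [left|rewrite commute -raM mulVKg].
Qed.

Lemma coupling_asymptotically_equivalent : asymptotically_equivalent F L.
Proof.
have [f Rf] := choice coupling_left_total.
have [f' Rf'] := choice coupling_right_total.
have cR := coupling_controlled; have cR' := coupling_controlled_sym.
exists f, f'; split.
- exact: controlled_asr_map Rf Rf' cR cR'.
(* The flipped relation exchanges the roles of [G] and [H], of [f] and [f'], and of the two control
   conditions. *)
- exact: controlled_asr_map Rf' Rf cR' cR.
- exact: controlled_section_close Rf Rf' cR'.
- exact: controlled_section_close Rf' Rf cR.
Qed.

End Coupling.

Close Scope group_scope.
Close Scope classical_set_scope.

Theorem proposition5p3 (G H : groupType) (F : set (set G)) (L : set (set H))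
    (genF : generating_family F) (genL : generating_family L) :
  admit_coupling F L -> asymptotically_equivalent F L.
Proof.
move=> [X [la [ra [[x0 _] laP raP commute [O domO]]]]].
exact: (coupling_asymptotically_equivalent genF genL x0 laP raP commute domO).
Qed.
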